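(* Fix $\mu\in X(\Bbbk)$. The quadratic map $\ker(\Phi_\mu)\to\mathrm{coker}(\Phi_\mu)$, $\alpha\mapsto[\Theta(\alpha,\alpha)]$, descends to a well-defined map $$\kappa^{\mathrm{inc}}_{2,\mu}\colon H^2_{\mathrm{inc}}(\mu)\longrightarrow H^3_{\mathrm{inc}}(\mu),\qquad \kappa^{\mathrm{inc}}_{2,\mu}([\alpha])=[\Theta(\alpha,\alpha)].$$ Moreover, for $\alpha\in\ker(\Phi_\mu)$, one has $\kappa^{\mathrm{inc}}_{2,\mu}([\alpha])=0$ if and only if the class $[\alpha]$ admits a second-order lift, i.e. there exists $\beta\in A_W$ such that $\mu+t\alpha+t^2\beta\in X\bigl(\Bbbk[t]/(t^3)\bigr)$.
   Context: $\Bbbk$ is an algebraically closed field of characteristic $0$, $W$ is a finite-dimensional $\Bbbk$-vector space, and $G=\mathrm{GL}(W)$ acts on $\mathrm{Hom}_\Bbbk(W\otimes W,W)$ by $(g\cdot\mu)(x,y)=g\,\mu(g^{-1}x,g^{-1}y)$; $\mathfrak g=\mathrm{Lie}(G)=\mathrm{End}(W)$. $A_W$ denotes one of the $G$-representations $\mathrm{Hom}(W^{\otimes 2},W)$, $\mathrm{Hom}(\mathrm{Sym}^2W,W)$, $\mathrm{Hom}(\Lambda^2W,W)$, also viewed as an affine space. $Q\subseteq \mathrm{Sym}^2(A_W^\vee)$ is a fixed $G$-stable subspace; each $q\in Q$ is regarded as a symmetric bilinear form $q(\nu_1,\nu_2)$ on $A_W$, with associated quadratic polynomial $f_q(\nu)=q(\nu,\nu)$.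 $X=\mathrm{Var}(Q)\subseteq A_W$ is the closed subscheme defined by the equations $f_q=0$, $q\in Q$. $\Theta\colon A_W\times A_W\to Q^\vee$ is the bilinear map $\Theta(\mu,\nu)(q)=q(\mu,\nu)$. For $\mu\in X(\Bbbk)$ put $\Phi_\mu\colon A_W\to Q^\vee$, $\Phi_\mu(\nu)=\Theta(\mu,\nu)$, and $\delta_\mu\colon\mathfrak g\to A_W$, $\delta_\mu(\xi)=\xi\cdot\mu$ (infinitesimal action). One has $\Phi_\mu\circ\delta_\mu=0$; set $H^2_{\mathrm{inc}}(\mu)=\ker(\Phi_\mu)/\mathrm{im}(\delta_\mu)$ and $H^3_{\mathrm{inc}}(\mu)=\mathrm{coker}(\Phi_\mu)$. *)

(* Defs.v *)
From HB Require Import structures.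
From mathcomp Require Import all_boot all_order all_algebra.
From mathcomp Require Import mpoly.

Set Implicit Arguments.
Unset Strict Implicit.
Unset Printing Implicit Defensive.

Import GRing.Theory.
Local Open Scope ring_scope.
Local Open Scope quotient_scope.

(* Bilinear maps in curried form: by the universal property of the tensor
   product, this is Hom(V (x) V, U). *)
Notation "''Bil' ( V , U )" := 'Hom(V, 'Hom(V, U))
  (at level 8, format "''Bil' ( V ,  U )") : type_scope.

Lemma linear_combD (R : pzRingType) (V : lmodType R) (a : R) (u v x y : V) :
  (a *: u + v) + (a *: x + y) = a *: (u + x) + (v + y).
Proof. by rewrite scalerDr addrACA. Qed.

Section Bilinear.
Variable k : fieldType.

Section Mk.
Variables V U : vectType k.

(* [linfun] is only meaningful on linear functions: see [mk_bilE]. *)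
Definition mk_bil (F : V -> V -> U) : 'Bil(V, U) :=
  linfun (fun x => linfun (F x)).

Lemma mk_bilE (F : V -> V -> U) :
  (forall x, linear (F x)) -> (forall y, linear (F^~ y)) ->
  forall x y, mk_bil F x y = F x y.
Proof.
move=> Fr Fl x y.
have Er z t : linfun (F z) t = F z t.
  pose L := GRing.isLinear.Build k V U *:%R (F z) (Fr z).
  pose H : {linear V -> U} := HB.pack (F z) L.
  exact: (lfunE H).
have Ll : linear (fun z => linfun (F z)).
  move=> a u v; apply/lfunP => t.
  by rewrite !lfun_simp !Er (Fl t).
pose L := GRing.isLinear.Build k V 'Hom(V, U) *:%R (fun z => linfun (F z)) Ll.
pose H : {linear V -> 'Hom(V, U)} := HB.pack (fun z => linfun (F z)) L.
by rewrite /mk_bil (lfunE H) Er.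
Qed.

Definition flip_bil (b : 'Bil(V, U)) : 'Bil(V, U) :=
  mk_bil (fun x y => b y x).

Lemma flip_bilE b x y : flip_bil b x y = b y x.
Proof.
by apply: mk_bilE => z a u v; rewrite ?linearP // !lfun_simp.
Qed.

Lemma flip_bil_is_linear : linear flip_bil.
Proof.
move=> a b c; apply/lfunP => x; apply/lfunP => y.
by rewrite !lfun_simp !flip_bilE !lfun_simp.
Qed.
HB.instance Definition _ :=
  GRing.isLinear.Build k 'Bil(V, U) 'Bil(V, U) *:%R flip_bil flip_bil_is_linear.

Definition sym_bil : {vspace 'Bil(V, U)} := lker (linfun flip_bil - \1)%VF.

Lemma sym_bilP (b : 'Bil(V, U)) : reflect (forall x y, b x y = b y x) (b \in sym_bil).
Proof.
rewrite memv_ker !lfun_simp subr_eq0; apply: (iffP eqP) => [E x y | E].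
  by rewrite -[LHS](flip_bilE b y x) (E : flip_bil b = b).
by apply/lfunP => x; apply/lfunP => y; rewrite flip_bilE.
Qed.

(* Skew-symmetric maps; in characteristic 0 (the only case in use) these are
   the alternating ones, i.e. Hom(Lambda^2 V, U): see [alt_bilP]. *)
Definition alt_bil : {vspace 'Bil(V, U)} := lker (linfun flip_bil + \1)%VF.

Lemma skew_bilP (b : 'Bil(V, U)) : reflect (forall x y, b x y = - b y x) (b \in alt_bil).
Proof.
rewrite memv_ker !lfun_simp addr_eq0; apply: (iffP eqP) => [E x y | E].
  by rewrite -(flip_bilE b x y) E !lfun_simp opprK.
by apply/lfunP => x; apply/lfunP => y; rewrite flip_bilE !lfun_simp.
Qed.

Lemma alt_bilP (b : 'Bil(V, U)) : [pchar k] =i pred0 ->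
  reflect (forall x, b x x = 0) (b \in alt_bil).
Proof.
move=> k0; apply: (iffP (skew_bilP b)) => [E x | E x y].
  have /eqP := E x x; rewrite -addr_eq0 -mulr2n -scaler_nat scaler_eq0.
  by rewrite ((pcharf0P k).1 k0) /= => /eqP.
apply/eqP; rewrite -addr_eq0.
have := E (x + y); rewrite !linearD /= !lfun_simp ?linearD /= !E.
by rewrite add0r addr0 addrC => ->.
Qed.

End Mk.
End Bilinear.

(* Only the quotient abelian group structure is kept, not the scaling. *)
Definition vquot (k : fieldType) (V : vectType k) (U : {vspace V}) :=
  Quotient.quot (pred_of_vspace U).
HB.instance Definition _ (k : fieldType) (V : vectType k) (U : {vspace V}) :=
  GRing.Zmodule.on (vquot U).
HB.instance Definition _ (k : fieldType) (V : vectType k) (U : {vspace V}) :=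
  EqQuotient.on (vquot U).

Lemma vquot_eqP (k : fieldType) (V : vectType k) (U : {vspace V}) (u v : V) :
  \pi_(vquot U) u = \pi_(vquot U) v <-> u - v \in U.
Proof.
split=> [/eqP E | E]; last apply/eqP.
  by rewrite (Quotient.idealrBE (pred_of_vspace U)) E.
by rewrite -(Quotient.idealrBE (pred_of_vspace U)).
Qed.

Lemma vquot_eq0P (k : fieldType) (V : vectType k) (U : {vspace V}) (u : V) :
  \pi_(vquot U) u = 0 <-> u \in U.
Proof.
have -> : 0 = \pi_(vquot U) 0 by rewrite [RHS]raddf0.
by rewrite vquot_eqP subr0.
Qed.

Inductive algebra_kind := AllAlg | CommAlg | SkewAlg.

Section Incidence.
Variables (k : fieldType) (W : vectType k).

Definition AW_space (c : algebra_kind) : {vspace 'Bil(W, W)} :=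
  match c with
  | AllAlg => fullv
  | CommAlg => sym_bil W W
  | SkewAlg => alt_bil W W
  end.

Variable c : algebra_kind.

Definition AW : vectType k := subvs_of (AW_space c).

Definition AW_fun (nu : AW) : 'Bil(W, W) := vsval nu.

(* The action is meaningful for g invertible. *)
Definition bil_act (g : 'End(W)) (m : 'Bil(W, W)) : 'Bil(W, W) :=
  mk_bil (fun x y => g (m ((g^-1)%VF x) ((g^-1)%VF y))).

Lemma bil_actE g m x y :
  bil_act g m x y = g (m ((g^-1)%VF x) ((g^-1)%VF y)).
Proof.
by rewrite /bil_act mk_bilE // => z a u v; rewrite !linearP //= !lfun_simp linearP.
Qed.

Lemma bil_act_AW g m : m \in AW_space c -> bil_act g m \in AW_space c.
Proof.
case: c => /=; first by rewrite !memvf.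
  by move=> /sym_bilP E; apply/sym_bilP => x y; rewrite !bil_actE E.
by move=> /skew_bilP E; apply/skew_bilP => x y; rewrite !bil_actE E linearN.
Qed.

Definition AW_act (g : 'End(W)) (nu : AW) : AW :=
  vsproj (AW_space c) (bil_act g (AW_fun nu)).

Lemma AW_actE g nu x y :
  AW_fun (AW_act g nu) x y = g (AW_fun nu ((g^-1)%VF x) ((g^-1)%VF y)).
Proof. by rewrite /AW_fun vsprojK ?bil_actE // bil_act_AW ?subvsP. Qed.

(* Derivative of the action of GL(W) at the identity. *)
Definition bil_lie (xi : 'End(W)) (m : 'Bil(W, W)) : 'Bil(W, W) :=
  mk_bil (fun x y => xi (m x y) - m (xi x) y - m x (xi y)).

Lemma bil_lieE xi m x y :
  bil_lie xi m x y = xi (m x y) - m (xi x) y - m x (xi y).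
Proof.
by rewrite /bil_lie mk_bilE // => z a u v;
  rewrite !linearP ?lfun_simp ?linearP /= ?lfun_simp ?linearP !linear_combD.
Qed.

Lemma bil_lie_AW xi m : m \in AW_space c -> bil_lie xi m \in AW_space c.
Proof.
case: c => /=; first by rewrite !memvf.
  move=> /sym_bilP E; apply/sym_bilP => x y; rewrite !bil_lieE.
  by rewrite (E x y) (E (xi x) y) (E x (xi y)) addrAC.
move=> /skew_bilP E; apply/skew_bilP => x y; rewrite !bil_lieE.
rewrite (E x y) (E (xi x) y) (E x (xi y)) linearN !opprD !opprK.
by rewrite addrAC.
Qed.

(* delta mu xi = xi . mu *)
Definition delta (mu : AW) : 'Hom('End(W), AW) :=
  linfun (fun xi => vsproj (AW_space c) (bil_lie xi (AW_fun mu))).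

Lemma deltaE mu xi x y :
  AW_fun (delta mu xi) x y =
    xi (AW_fun mu x y) - AW_fun mu (xi x) y - AW_fun mu x (xi y).
Proof.
set F := fun xi => vsproj (AW_space c) (bil_lie xi (AW_fun mu)).
have FE z : AW_fun (F z) = bil_lie z (AW_fun mu).
  by rewrite /AW_fun vsprojK // bil_lie_AW ?subvsP.
have Fl : linear F.
  move=> a u v; apply: val_inj; apply/lfunP => z; apply/lfunP => t.
  rewrite -[LHS]/(AW_fun (F (a *: u + v)) z t) FE.
  rewrite -[RHS]/((a *: AW_fun (F u) + AW_fun (F v)) z t) !lfun_simp !FE.
  by rewrite !bil_lieE !lfun_simp !linearP /= ?lfun_simp ?linearP !linear_combD.
pose L := GRing.isLinear.Build k 'End(W) AW *:%R F Fl.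
pose H : {linear 'End(W) -> AW} := HB.pack F L.
by rewrite /delta (lfunE H) FE bil_lieE.
Qed.

(* Sym^2 of the dual of A_W, as symmetric bilinear forms. *)
Definition form_act (g : 'End(W)) (q : 'Bil(AW, k^o)) : 'Bil(AW, k^o) :=
  mk_bil (fun n1 n2 => q (AW_act (g^-1)%VF n1) (AW_act (g^-1)%VF n2)).

Lemma AW_act_is_linear g : linear (AW_act g).
Proof.
move=> a u v; apply: val_inj; apply/lfunP => x; apply/lfunP => y.
rewrite -[LHS]/(AW_fun (AW_act g (a *: u + v)) x y) AW_actE.
rewrite -[RHS]/((a *: AW_fun (AW_act g u) + AW_fun (AW_act g v)) x y).
rewrite !lfun_simp !AW_actE.
by rewrite linearP.
Qed.
HB.instance Definition _ g :=
  GRing.isLinear.Build k AW AW *:%R (AW_act g) (AW_act_is_linear g).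

Lemma form_actE g q n1 n2 :
  form_act g q n1 n2 = q (AW_act (g^-1)%VF n1) (AW_act (g^-1)%VF n2).
Proof.
by rewrite /form_act mk_bilE // => z a u v; rewrite !linearP ?lfun_simp.
Qed.

Variable Q : {vspace 'Bil(AW, k^o)}.

Definition GL_stable : Prop :=
  forall g : 'End(W), bijective g -> forall q, q \in Q -> form_act g q \in Q.

(* Coordinates on the affine space A_W, in the basis chosen by the library. *)
Definition dimA : nat := \dim (fullv : {vspace AW}).
Definition basisA : dimA.-tuple AW := vbasis fullv.
Definition coordA (nu : AW) (i : 'I_dimA) : k := coord basisA i nu.

Definition quad_poly (q : 'Bil(AW, k^o)) : {mpoly k[dimA]} :=
  \sum_(i < dimA) \sum_(j < dimA)
    (q (tnth basisA i) (tnth basisA j) : k) *: ('X_i * 'X_j).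

Lemma quad_polyE q nu : (quad_poly q).@[coordA nu] = q nu nu.
Proof.
have E : nu = \sum_(i < dimA) coordA nu i *: tnth basisA i.
  rewrite {1}(coord_vbasis (memvf nu)); apply: eq_bigr => i _.
  by rewrite (tnth_nth 0).
rewrite /quad_poly raddf_sum /= [X in q X _]E linear_sum sum_lfunE /=.
apply: eq_bigr => i _; rewrite raddf_sum /= linearZ !lfun_simp [X in _ *: q _ X]E.
rewrite linear_sum scaler_sumr; apply: eq_bigr => j _ /=.
rewrite mevalZ mevalM !mevalXU linearZ /=.
by rewrite [RHS]mulrA mulrC.
Qed.

(* R-points of X = Var(Q), i.e. k-algebra morphisms k[A_W]/(f_q) -> R,
   given by the images of the coordinate functions. *)
Definition Xpt (R : comAlgType k) (v : 'I_dimA -> R) : Prop :=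
  forall q, q \in Q -> mmap (in_alg R) v (quad_poly q) = 0.

Definition Theta (m n : AW) : 'Hom(subvs_of Q, k^o) :=
  linfun (fun q : subvs_of Q => vsval q m n).

Lemma ThetaE m n (q : subvs_of Q) : Theta m n q = vsval q m n.
Proof.
pose F := fun q : subvs_of Q => vsval q m n.
have Fl : linear (F : subvs_of Q -> k^o).
  by move=> a u v; rewrite /F linearP /= !lfun_simp.
pose L := GRing.isLinear.Build k (subvs_of Q) k^o *:%R F Fl.
pose H : {linear subvs_of Q -> k^o} := HB.pack F L.
by rewrite /Theta (lfunE H).
Qed.

Definition Phi (mu : AW) : 'Hom(AW, 'Hom(subvs_of Q, k^o)) :=
  linfun (Theta mu).

Lemma PhiE mu nu : Phi mu nu = Theta mu nu.
Proof.
have Fl : linear (Theta mu).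
  by move=> a u v; apply/lfunP => q; rewrite !lfun_simp !ThetaE linearP.
pose L := GRing.isLinear.Build k AW _ *:%R (Theta mu) Fl.
pose H : {linear AW -> 'Hom(subvs_of Q, k^o)} := HB.pack (Theta mu) L.
by rewrite /Phi (lfunE H).
Qed.

(* When Q is GL-stable and mu is a k-point of X, Phi mu \o delta mu = 0, so this
   preimage under ker(Phi mu) -> A_W is all of im(delta mu). *)
Definition im_delta_in_ker (mu : AW) : {vspace subvs_of (lker (Phi mu))} :=
  (linfun (@vsval _ _ (lker (Phi mu))) @^-1: limg (delta mu))%VS.

Definition H2inc (mu : AW) := vquot (im_delta_in_ker mu).
Definition H3inc (mu : AW) := vquot (limg (Phi mu)).

End Incidence.

Notation truncated3 k := {poly %/ ('X^3 : {poly k})}.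

Lemma truncated3_modulus (k : fieldType) :
  mk_monic ('X^3 : {poly k}) = 'X^3.
Proof. by rewrite /mk_monic size_polyXn monicXn. Qed.

(* The k[t]/(t^3)-point mu + t alpha + t^2 beta of A_W; 'qX is the class of t. *)
Definition second_order_arc (k : fieldType) (W : vectType k) (c : algebra_kind)
    (mu alpha beta : AW W c) (i : 'I_(dimA W c)) : truncated3 k :=
  (coordA mu i)%:A + coordA alpha i *: 'qX + coordA beta i *: 'qX ^+ 2.

(* Main.v *)
Require Import Defs.
From HB Require Import structures.
From mathcomp Require Import all_boot all_order all_algebra.
From mathcomp Require Import mpoly.
From mathcomp Require Import ring.

Set Implicit Arguments.
Unset Strict Implicit.
Unset Printing Implicit Defensive.

Import GRing.Theory.
Local Open Scope ring_scope.
Local Open Scope quotient_scope.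

(** Let [alpha] and [alpha'] in the kernel of [Phi mu] differ by [xi.mu]. By
    polarization [Theta alpha alpha - Theta alpha' alpha'] is the sum of
    [Theta alpha (xi.mu)] and [Theta alpha' (xi.mu)], and each of these lies in the
    image of [Phi mu]: since [Q] is stable under the Lie algebra and [alpha] is
    orthogonal to [mu] for all forms of [Q], one has
    [q(alpha, xi.mu) + q(mu, xi.alpha) = 0], that is,
    [Theta alpha (xi.mu) = Phi mu (- xi.alpha)] ([Theta_delta_in_im]). Hence the
    class of [Theta alpha alpha] in the cokernel depends only on that of [alpha].

    Stability under the Lie algebra has to be derived from stability under the
    group. Every endomorphism is a combination of idempotents
    ([idempotents_span_End]), and for an idempotent [p] the family
    [h = 1 + u p] acts, up to the factor [(1 + u)^2], by an expression that is
    polynomial in [u] ([AW_act_idempotent]). If all forms of [Q] vanish on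
    [(m, n)], they vanish on [(h m, h n)] for infinitely many [u], so that the
    coefficient of [u] in the resulting polynomial is zero; this is the
    infinitesimal relation ([GL_stable_infinitesimal]).

    As for lifts, substituting [mu + t alpha + t^2 beta] in the equation of [q]
    leaves [(2 q(mu, beta) + q(alpha, alpha)) t^2] modulo [t^3]
    ([second_order_arcP]). The arc lies on [X] exactly when
    [Theta alpha alpha = Phi mu (-2 beta)], and as 2 is invertible such a [beta]
    exists exactly when [Theta alpha alpha] is in the image of [Phi mu]. *)

(** * Idempotents and polynomial arcs *)

Section LinearAlgebra.
Variable k : fieldType.

(** Comparing coordinates turns an identity between linear combinations of
    vectors into a commutative one, which [ring] and [field] decide. *)
Lemma coord_vbasis_inj (V : vectType k) (v w : V) :
  (forall i, coord (vbasis fullv) i v = coord (vbasis fullv) i w) -> v = w.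
Proof.
move=> E; rewrite (coord_vbasis (memvf v)) (coord_vbasis (memvf w)).
by apply: eq_bigr => i _; rewrite E.
Qed.

Lemma inv_lfunE (V : vectType k) (h g : 'End(V)) :
  cancel h g -> cancel g h -> (h^-1)%VF = g.
Proof.
move=> hK gK; have ker_h : lker h == 0%VS.
  by apply/lker0P => x y /(congr1 g); rewrite !hK.
by apply/lfunP => x; rewrite -{1}(gK x) lker0_lfunK.
Qed.

(** The maps [1 + u p] with [p] idempotent form a one-parameter family in the
    linear group: [1 + u p] is multiplication by [1 + u] on the image of [p] and
    the identity on its kernel. Its inverse is rational in [u] with the single
    denominator [1 + u], which is the reason for restricting to such [p]. *)
Lemma idempotent_homothetyK (V : vectType k) (p : 'End(V)) (u : k) :
  (forall x, p (p x) = p x) -> 1 + u != 0 ->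
  cancel (\1 + u *: p)%VF (\1 - ((1 + u)^-1 * u) *: p)%VF
  /\ cancel (\1 - ((1 + u)^-1 * u) *: p)%VF (\1 + u *: p)%VF.
Proof.
move=> pp u1; split=> x; rewrite !lfun_simp !(linearD, linearN, linearZ) /= !pp;
  apply: coord_vbasis_inj => i; rewrite !(linearD, linearN, linearZ) /=;
  by field.
Qed.

Definition rank1 (V : vectType k) (v : V) (i : 'I_(\dim (fullv : {vspace V}))) :
  'End(V) := linfun (fun x => coord (vbasis fullv) i x *: v).

Lemma rank1E (V : vectType k) (v : V) i x :
  rank1 v i x = coord (vbasis fullv) i x *: v.
Proof.
pose F y := coord (vbasis (fullv : {vspace V})) i y *: v.
have Fl : linear F by move=> a y z; rewrite /F linearP scalerDl scalerA.
pose L := GRing.isLinear.Build k V V *:%R F Fl.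
pose H : {linear V -> V} := HB.pack F L.
exact: (lfunE H).
Qed.

(** [f] is the sum over a basis [e] of the rank one maps [x |-> e_i^*(x) f(e_i)],
    and [x |-> e_i^*(x) v] is idempotent as soon as [e_i^*(v) = 1]. An arbitrary
    [v] is brought to this case by subtracting a multiple of [e_i]. *)
Lemma idempotents_span_End (V : vectType k) (P : 'End(V) -> Prop) :
  P 0 -> (forall a f g, P f -> P g -> P (a *: f + g)) ->
  (forall p : 'End(V), (forall x, p (p x) = p x) -> P p) ->
  forall f, P f.
Proof.
move=> P0 PD Pp f; set e := vbasis (fullv : {vspace V}).
have P1 v i : coord e i v = 1 -> P (rank1 v i).
  by move=> v1; apply: Pp => x; rewrite !rank1E linearZ /= v1 mulr1.
have ei i : coord e i e`_i = 1.
  by rewrite coord_free ?eqxx // (basis_free (vbasisP _)).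
have Pr v i : P (rank1 v i).
  have -> : rank1 v i = (coord e i v - 1) *: rank1 e`_i i
      + rank1 (v - (coord e i v - 1) *: e`_i) i.
    apply/lfunP => x; rewrite !lfun_simp !rank1E.
    by rewrite scalerBr !scalerA mulrC addrC subrK.
  apply: PD; apply: P1 => //.
  by rewrite linearB linearZ /= ei mulr1 opprB addrC subrK.
have -> : f = \sum_(i < \dim (fullv : {vspace V})) rank1 (f e`_i) i.
  apply/lfunP => x; rewrite {1}(coord_vbasis (memvf x)) linear_sum sum_lfunE.
  by apply: eq_bigr => i _; rewrite linearZ rank1E.
elim/big_ind: _ => // g h Pg Ph; rewrite -[g]scale1r; exact: PD.
Qed.

Lemma poly_natr_eq0 (k0 : [pchar k] =i pred0) (p : {poly k}) :
  (forall n : nat, p.[n%:R] = 0) -> p = 0.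
Proof.
move=> pn; apply/eqP; apply/negPn/negP => p0.
have natr_inj : injective (fun n : nat => n%:R : k).
  move=> i j; wlog ij : i j / (i <= j)%N => [IH E | /esym/eqP].
    by case: (leqP i j) => [|/ltnW] ij; [| symmetry]; apply: IH.
  rewrite -subr_eq0 -natrB // ((pcharf0P k).1 k0) subn_eq0 => ji.
  by apply/eqP; rewrite eqn_leq ij ji.
pose rs := [seq n%:R : k | n <- iota 0 (size p)].
have := @max_poly_roots _ p rs p0.
rewrite size_map size_iota ltnn map_inj_uniq // iota_uniq => /(_ _ isT).
have -> // : all (root p) rs by apply/allP => _ /mapP[n _ ->]; exact/rootP.
by move/(_ isT).
Qed.

(** This replaces differentiation at [u = 0]: the values of [q] on a pair of cubic
    arcs form a polynomial in [u] of degree at most 6 with infinitely many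
    zeros, and the conclusion is the vanishing of its coefficient of [u]. *)
Lemma bil_cubic_eq0 (k0 : [pchar k] =i pred0) (V : vectType k)
    (q : 'Bil(V, k^o)) (m a1 a2 a3 n b1 b2 b3 : V) :
  (forall i : nat, let u : k := i%:R in
    q (m + u *: a1 + u ^+ 2 *: a2 + u ^+ 3 *: a3)
      (n + u *: b1 + u ^+ 2 *: b2 + u ^+ 3 *: b3) = 0) ->
  q m b1 + q a1 n = 0.
Proof.
move=> q0.
pose r : {poly k} := Poly [:: q m n; q m b1 + q a1 n;
  q m b2 + q a1 b1 + q a2 n; q m b3 + q a1 b2 + q a2 b1 + q a3 n;
  q a1 b3 + q a2 b2 + q a3 b1; q a2 b3 + q a3 b2; q a3 b3].
suff r0 : r = 0.
  by have := congr1 (fun s : {poly k} => s`_1) r0; rewrite coef_Poly coef0.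
apply: poly_natr_eq0 => // i; rewrite horner_Poly /= -[RHS](q0 i).
rewrite !linearD !linearZ /= !lfun_simp !linearD !linearZ /= /GRing.scale /=.
by ring.
Qed.

End LinearAlgebra.

(** * From stability under the group to stability under its Lie algebra *)

Section InfinitesimalStability.
Variables (k : fieldType) (W : vectType k) (c : algebra_kind).
Hypothesis k0 : [pchar k] =i pred0.
Implicit Types (m n : AW W c) (p : 'End(W)) (M : 'Bil(W, W)).

Definition post_bil p M : 'Bil(W, W) := mk_bil (fun x y => p (M x y)).

Lemma post_bilE p M x y : post_bil p M x y = p (M x y).
Proof.
by rewrite /post_bil mk_bilE // => z a u v;
  rewrite ?linearP // !lfun_simp linearP.
Qed.

Definition pre1_bil p M : 'Bil(W, W) := (M \o p)%VF.

Lemma pre1_bilE p M x y : pre1_bil p M x y = M (p x) y.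
Proof. by rewrite /pre1_bil lfun_simp. Qed.

Definition pre2_bil p M : 'Bil(W, W) := flip_bil (pre1_bil p (flip_bil M)).

Lemma pre2_bilE p M x y : pre2_bil p M x y = M x (p y).
Proof. by rewrite /pre2_bil flip_bilE pre1_bilE flip_bilE. Qed.

(** With [h = 1 + u p] one has [(1 + u) h^-1 = 1 + u (1 - p)], so multiplying
    [h m(h^-1 x, h^-1 y)] by [(1 + u)^2] clears the denominators and leaves a
    cubic in [u]. Only its coefficients up to [u] matter; the term [2 m] in the
    linear one is the derivative of the factor [(1 + u)^2]. *)
Lemma AW_act_idempotent p m (pp : forall x, p (p x) = p x) :
  exists a b, forall u : k, 1 + u != 0 ->
    (1 + u) ^+ 2 *: AW_act (\1 + u *: p)%VF m
    = m + u *: (2 *: m + delta m p) + u ^+ 2 *: a + u ^+ 3 *: b.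
Proof.
pose M := AW_fun m; pose p' := (\1 - p)%VF.
pose M1 := pre1_bil p' M; pose M2 := pre2_bil p' M; pose M12 := pre2_bil p' M1.
pose a := post_bil p M1 + post_bil p M2 + M12; pose b := post_bil p M12.
exists (vsproj _ a), (vsproj _ b) => u u1.
pose v := (1 + u)^-1 * u; pose g : 'End(W) := (\1 - v *: p)%VF.
have [hK gK] := idempotent_homothetyK pp u1.
have invE := inv_lfunE hK gK : ((\1 + u *: p)^-1)%VF = g.
have -> : delta m p = vsproj _ (bil_lie p M).
  rewrite -[LHS]vsvalK; congr (vsproj _ _); apply/lfunP => x; apply/lfunP => y.
  by rewrite bil_lieE; exact: deltaE.
(* [vsproj] is linear, so the identity in [AW W c] follows from one between bilinear
   maps on [W]. *)
transitivity
  (vsproj (AW_space W c) ((1 + u) ^+ 2 *: bil_act (\1 + u *: p)%VF M)).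
  by rewrite linearZ.
transitivity (vsproj (AW_space W c)
  (M + u *: (2 *: M + bil_lie p M) + u ^+ 2 *: a + u ^+ 3 *: b)); last first.
  rewrite !(linearD, linearZ) /= vsvalK !scalerDr.
  by rewrite [u *: (2 *: m)]scalerA mulrC -scalerA.
congr (vsproj _ _); apply/lfunP => x; apply/lfunP => y.
have lieE : 2 *: M x y + bil_lie p M x y = p (M x y) + M (p' x) y + M x (p' y).
  rewrite bil_lieE !lfun_simp linearB /= !lfun_simp scaler_nat mulr2n.
  rewrite linearB /=; apply: coord_vbasis_inj => i.
  by rewrite !(linearD, linearN) /=; ring.
have gE z : (1 + u) *: g z = z + u *: p' z.
  by rewrite !lfun_simp !scalerBr scalerA mulVKf // scalerDl scale1r addrA.
have scaleM z t : (1 + u) ^+ 2 *: M z t = M ((1 + u) *: z) ((1 + u) *: t).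
  by rewrite !linearZ /= lfun_simp scalerA.
have actE : ((1 + u) ^+ 2 *: bil_act (\1 + u *: p)%VF M) x y
    = (\1 + u *: p)%VF (M (x + u *: p' x) (y + u *: p' y)).
  by rewrite scale_lfunE scale_lfunE bil_actE invE -linearZ scaleM !gE.
(* The two sides are now polynomials in [u] whose coefficients are the values of
   [M] at [x], [y], [p' x], [p' y] and the images of these values under [p]. *)
rewrite actE /a /b; clearbody p'.
rewrite !(add_lfunE, scale_lfunE) lieE id_lfunE !post_bilE !pre2_bilE !pre1_bilE.
move: (p' x) (p' y) => x' y'.
rewrite !(linearD, linearZ) /= !lfun_simp !(linearD, linearZ) /=.
move: (M x y) (M x' y) (M x y') (M x' y') => A B C D.
apply: coord_vbasis_inj => i; rewrite !(linearD, linearZ) /=.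
by ring.
Qed.

Variable Q : {vspace 'Bil(AW W c, k^o)}.
Hypothesis Qstable : GL_stable Q.

(** The common orthogonality of [m] and [n] with respect to all forms of [Q] is
    invariant under the diagonal action of the linear group. *)
Lemma GL_stable_form0 m n (h : 'End(W)) : bijective h ->
  (forall q, q \in Q -> q m n = 0) ->
  forall q, q \in Q -> q (AW_act h m) (AW_act h n) = 0.
Proof.
case=> g hK gK q0 q Qq.
have ker_h : lker h == 0%VS by apply/lker0P; exact: can_inj hK.
have Vh : cancel h (h^-1)%VF := lker0_lfunK ker_h.
have hV : cancel (h^-1)%VF h := lker0_lfunVK ker_h.
have Vbij : bijective (h^-1)%VF by exists h.
by have := q0 _ (Qstable Vbij Qq); rewrite form_actE (inv_lfunE hV Vh).
Qed.

(** The derivative of [GL_stable_form0] at the identity. Both terms are linear in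
    [xi], so it suffices to treat [xi] idempotent, where the orbit maps are
    polynomial arcs up to a scalar. *)
Lemma GL_stable_infinitesimal m n (xi : 'End(W)) :
  (forall q, q \in Q -> q m n = 0) ->
  forall q, q \in Q -> q m (delta n xi) + q (delta m xi) n = 0.
Proof.
move=> q0 q Qq; elim/idempotents_span_End: xi => [|a f g IHf IHg|p pp].
- by rewrite !linear0 lfun_simp addr0.
- rewrite !linearP /= !lfun_simp addrACA IHg addr0 -scalerDr IHf.
  by rewrite scaler0.
have [a [b E]] := AW_act_idempotent m pp.
have [a' [b' E']] := AW_act_idempotent n pp.
have := @bil_cubic_eq0 _ k0 _ q m (2 *: m + delta m p) a b
  n (2 *: n + delta n p) a' b'.
(* The contributions of [2 m] and [2 n] are multiples of [q m n], which is 0. *)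
rewrite !(linearD, linearZ) /= !lfun_simp q0 // scaler0 !add0r; apply=> i /=.
(* The integers avoid the excluded value [u = -1] in characteristic 0. *)
have u1 : 1 + i%:R != 0 :> k by rewrite -mulrS ((pcharf0P k).1 k0).
rewrite -E // -E' // !linearZ /= lfun_simp GL_stable_form0 ?scaler0 //.
by have [hK gK] := idempotent_homothetyK pp u1; exact: Bijective hK gK.
Qed.

End InfinitesimalStability.

(** * The quadrics on arcs of order two *)

Section QuadricsOnArcs.
Variables (k : fieldType) (W : vectType k) (c : algebra_kind).
Implicit Types (q : 'Bil(AW W c, k^o)) (m n : AW W c).

Lemma coordA_sum m :
  m = \sum_(i < dimA W c) coordA m i *: tnth (basisA W c) i.
Proof.
rewrite {1}(coord_vbasis (memvf m)); apply: eq_bigr => i _.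
by rewrite (tnth_nth 0).
Qed.

Lemma bil_coordA q m n :
  q m n = \sum_(i < dimA W c) \sum_(j < dimA W c)
    (q (tnth (basisA W c) i) (tnth (basisA W c) j) : k)
      * (coordA m i * coordA n j).
Proof.
rewrite {1}(coordA_sum m) linear_sum sum_lfunE /=; apply: eq_bigr => i _.
rewrite linearZ !lfun_simp {1}(coordA_sum n) linear_sum scaler_sumr.
apply: eq_bigr => j _ /=; rewrite linearZ /=.
by rewrite [LHS]mulrA mulrC.
Qed.

Lemma mmap_quad_poly (R : comAlgType k) (v : 'I_(dimA W c) -> R) q :
  mmap (in_alg R) v (quad_poly q) = \sum_(i < dimA W c) \sum_(j < dimA W c)
    (q (tnth (basisA W c) i) (tnth (basisA W c) j) : k) *: (v i * v j).
Proof.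
rewrite /quad_poly raddf_sum; apply: eq_bigr => i _.
rewrite raddf_sum; apply: eq_bigr => j _ /=.
have vC l (x : R) : GRing.comm x (v l) by exact: mulrC.
by rewrite mmapZ -mpolyXD mmapX commr_mmap1_M ?mmap1U /= ?mulr_algl.
Qed.

(** The arc is given in coordinates and [q] as a bilinear form; since each monomial
    [X_i X_j] is itself bilinear in the coordinates, the expansion modulo [t^3]
    can be done one pair of indices at a time. *)
Lemma quad_poly_arc (R : comAlgType k) (t : R) (t3 : t ^+ 3 = 0) m a b q :
  mmap (in_alg R)
    (fun i => (coordA m i)%:A + coordA a i *: t + coordA b i *: t ^+ 2)
    (quad_poly q)
  = (q m m : k)%:A + (q m a + q a m : k) *: t
    + (q m b + q b m + q a a : k) *: t ^+ 2.
Proof.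
rewrite mmap_quad_poly !bil_coordA -!big_split /= !scaler_suml -!big_split /=.
apply: eq_bigr => i _; rewrite -!big_split /= !scaler_suml -!big_split /=.
apply: eq_bigr => j _.
set e : k := q _ _; rewrite -!mulrDr -!scalerA -!scalerDr; congr (_ *: _).
have arcM (x x' y y' z z' : R) :
    (x + y * t + z * t ^+ 2) * (x' + y' * t + z' * t ^+ 2) =
    x * x' + (x * y' + y * x') * t + (x * z' + z * x' + y * y') * t ^+ 2.
  (* The part of the product of order at least 3 is made explicit for [ring]. *)
  transitivity (x * x' + (x * y' + y * x') * t
    + (x * z' + z * x' + y * y') * t ^+ 2
    + (y * z' + z * y' + z * z' * t) * t ^+ 3); first by ring.
  by rewrite t3 mulr0 addr0.
rewrite -!(mulr_algl _ t) -!(mulr_algl _ (t ^+ 2)) -!in_algE arcM.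
by rewrite !(rmorphD, rmorphM) /= -[coordA m i *: _%:A]mulr_algl.
Qed.

End QuadricsOnArcs.

Section Truncated.
Variable k : fieldType.

Lemma qX_expE n : ('qX : truncated3 k) ^+ n = in_qpoly 'X^3 'X^n.
Proof. by rewrite rmorphXn. Qed.

Lemma qX_exp3 : ('qX : truncated3 k) ^+ 3 = 0.
Proof.
rewrite qX_expE; apply: val_inj => /=.
by rewrite truncated3_modulus Pdiv.RingMonic.rmodpp ?monicXn.
Qed.

Lemma qX_exp2_neq0 : ('qX : truncated3 k) ^+ 2 != 0.
Proof.
rewrite qX_expE; apply/eqP => /(congr1 val) /=.
have -> : Pdiv.CommonRing.rmodp 'X^2 (mk_monic ('X^3 : {poly k})) = 'X^2.
  by rewrite Pdiv.Ring.rmodp_small // truncated3_modulus !size_polyXn.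
by apply/eqP; rewrite monic_neq0 ?monicXn.
Qed.

End Truncated.

(** * The obstruction map *)

Section Obstruction.
Variables (k : fieldType) (W : vectType k) (c : algebra_kind).
Hypothesis k0 : [pchar k] =i pred0.
Variable Q : {vspace 'Bil(AW W c, k^o)}.
Hypothesis Qsym : (Q <= sym_bil (AW W c) k^o)%VS.

Lemma Q_sym q x y : q \in Q -> q x y = q y x.
Proof. by move=> /(subvP Qsym) /sym_bilP ->. Qed.

Lemma Phi0P mu (a : AW W c) :
  reflect (forall q, q \in Q -> q mu a = 0) (a \in lker (Phi Q mu)).
Proof.
rewrite memv_ker PhiE; apply: (iffP eqP) => [E q Qq | E].
  by rewrite -(vsprojK Qq) -ThetaE E lfun_simp.
by apply/lfunP => q; rewrite ThetaE lfun_simp E ?subvsP.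
Qed.

(** Infinitesimal stability gives [q(a, xi.mu) = - q(mu, xi.a)], and the right side
    is the value of [Phi mu] at [- xi.a]. *)
Lemma Theta_delta_in_im (Qstable : GL_stable Q) mu a xi :
  a \in lker (Phi Q mu) -> Theta Q a (delta mu xi) \in limg (Phi Q mu).
Proof.
move=> /Phi0P mua; apply/memv_imgP; exists (- delta a xi); first exact: memvf.
rewrite PhiE; apply/lfunP => q; rewrite !ThetaE linearN /=.
have Qq := subvsP q; apply/eqP; rewrite -addr_eq0 Q_sym // addrC.
by rewrite (GL_stable_infinitesimal k0 Qstable xi mua).
Qed.

(** Polarization, in the form that makes the change of [Theta a a] visibly a sum of
    two terms [Theta _ (a - b)]. *)
Lemma Theta_sqrB a b :
  Theta Q a a - Theta Q b b = Theta Q a (a - b) + Theta Q b (a - b).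
Proof.
apply/lfunP => q; rewrite !lfun_simp !ThetaE !linearB /=.
by rewrite (Q_sym b a (subvsP q)) addrA subrK.
Qed.

(** The coefficients of [1] and [t] in the equations of the arc vanish because [mu]
    lies on [X] and [a] in the kernel; the coefficient of [t^2] is
    [2 q(mu, b) + q(a, a)]. *)
Lemma second_order_arcP mu a b :
  Xpt Q (R := k^o) (coordA mu) -> a \in lker (Phi Q mu) ->
  Xpt Q (R := truncated3 k) (second_order_arc mu a b) <->
  Theta Q a a = Phi Q mu ((-2) *: b).
Proof.
move=> muX /Phi0P mua.
have arcE q : q \in Q ->
    mmap (in_alg (truncated3 k)) (second_order_arc mu a b) (quad_poly q)
    = (2 * q mu b + q a a : k) *: 'qX ^+ 2.
  move=> Qq; rewrite (quad_poly_arc (qX_exp3 k)).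
  have muq : q mu mu = 0.
    by have := muX q Qq; rewrite mmap_quad_poly bil_coordA.
  rewrite muq (Q_sym a mu Qq) (Q_sym b mu Qq) mua // addr0 !scale0r !add0r.
  by rewrite mulr_natl mulr2n.
split=> [arcX | E q Qq].
  rewrite PhiE; apply/lfunP => q; have Qq := subvsP q.
  have /eqP := arcX _ Qq; rewrite arcE // scaler_eq0 (negPf (qX_exp2_neq0 k)).
  rewrite orbF addrC addr_eq0 !ThetaE linearZ => /eqP ->.
  by rewrite /= /GRing.scale /= mulNr.
rewrite arcE //.
suff -> : (2 * q mu b + q a a : k) = 0 by rewrite scale0r.
have := congr1 (fun l : 'Hom(subvs_of Q, k^o) => l (vsproj Q q)) E.
rewrite PhiE !ThetaE vsprojK // linearZ => ->.
by rewrite /= /GRing.scale /= mulNr subrr.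
Qed.

End Obstruction.

Theorem proposition3p4 (k : closedFieldType) (chark : [pchar k] =i pred0)
    (W : vectType k) (c : algebra_kind)
    (Q : {vspace 'Bil(AW W c, k^o)})
    (Qsym : (Q <= sym_bil (AW W c) k^o)%VS) (Qstable : GL_stable Q)
    (mu : AW W c) (muX : Xpt Q (R := k^o) (coordA mu)) :
  exists kappa : H2inc Q mu -> H3inc Q mu,
    (forall alpha : subvs_of (lker (Phi Q mu)),
       kappa (\pi_(H2inc Q mu) alpha) =
         \pi_(H3inc Q mu) (Theta Q (vsval alpha) (vsval alpha)))
    /\ (forall alpha : subvs_of (lker (Phi Q mu)),
          kappa (\pi_(H2inc Q mu) alpha) = 0 <->
          exists beta : AW W c,
            Xpt Q (R := truncated3 k)
              (second_order_arc mu (vsval alpha) beta)).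
Proof.
pose sq (x : subvs_of (lker (Phi Q mu))) := Theta Q (vsval x) (vsval x).
(* Any set-theoretic section defines the map; [kappaE] is independence of it. *)
exists (fun x : H2inc Q mu => \pi_(H3inc Q mu) (sq (repr x))).
have kappaE (alpha : subvs_of (lker (Phi Q mu))) :
    \pi_(H3inc Q mu) (sq (repr (\pi_(H2inc Q mu) alpha)))
    = \pi_(H3inc Q mu) (sq alpha).
  set alpha' := repr _.
  have /vquot_eqP : \pi_(H2inc Q mu) alpha' = \pi_(H2inc Q mu) alpha.
    exact: reprK.
  rewrite -memv_preim lfunE => /memv_imgP[xi _ E].
  apply/vquot_eqP; rewrite /sq Theta_sqrB // -linearB E.
  by apply: memvD; apply: Theta_delta_in_im => //; exact: subvsP.
split=> [//|alpha]; rewrite kappaE vquot_eq0P.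
have two_neq0 : -2 != 0 :> k by rewrite oppr_eq0 ((pcharf0P k).1 chark).
split=> [/memv_imgP[nu _ E] | [beta /second_order_arcP E]].
  exists ((-2)^-1 *: nu); apply/second_order_arcP => //; first exact: subvsP.
  by rewrite scalerA divff // scale1r.
by rewrite /sq E ?memv_img ?memvf ?subvsP.
Qed.
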